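(* Let $G$ be a countable abelian group and let $(X,G)$ be a minimal dynamical system whose enveloping semigroup $E(X)$ is a top-nilpotent group (that is, $E(X)$ is a group which is $d$-step top-nilpotent for some $d\in\mathbb{N}$). Then $(X,G)$ is a system of order $\infty$, i.e. $\mathbf{RP}^{[\infty]}(X)=\{(x,x):x\in X\}$.
   Context: A dynamical system $(X,G)$ is a compact metric space $(X,\rho)$ with an action of a countable abelian group $G$ (written additively) by homeomorphisms; it is minimal if every orbit is dense. The enveloping semigroup $E(X)$ is the closure of $\{x\mapsto gx : g\in G\}$ in $X^X$ with the product (pointwise convergence) topology. Top-nilpotency: if $E=E(X)$ is a group, put $E_1^{\mathrm{top}}=E$ and let $E_{j+1}^{\mathrm{top}}$ be the closure of the subgroup $[E_j^{\mathrm{top}},E]$ generated by the commutators $[a,b]=aba^{-1}b^{-1}$, $a\in E_j^{\mathrm{top}}$, $b\in E$. $E$ is $d$-step top-nilpotent if $E_{d+1}^{\mathrm{top}}$ is trivial. Regional proximality: for $d\in\mathbb{N}$, $(x,y)\in\mathbf{RP}^{[d]}(X)$ iff for every $\delta>0$ there exist $x',y'\in X$ and $\vec g=(g_1,\dots,g_d)\in G^d$ with $\rho(x,x')<\delta$, $\rho(y,y')<\delta$ and $\rho((\vec g\cdot\epsilon)x',(\vec g\cdot\epsilon)y')<\delta$ for all $\epsilon\in\{0,1\}^d\setminus\{\vec 0\}$, where $\vec g\cdot\epsilon=\sum_{i=1}^d \epsilon_i g_i$. Set $\mathbf{RP}^{[\infty]}(X)=\bigcap_{d\ge1}\mathbf{RP}^{[d]}(X)$.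 *)

(* Defs.v *)
From HB Require Import structures.
From mathcomp Require Import all_boot all_order all_algebra.
From mathcomp Require Import all_classical all_reals.
From mathcomp Require Import topology.

Set Implicit Arguments.
Unset Strict Implicit.
Unset Printing Implicit Defensive.

Import GRing.Theory Num.Theory.
Local Open Scope classical_set_scope.
Local Open Scope ring_scope.

(* Each [act g] is a homeomorphism: its inverse is [act (- g)]. *)
Record dynamical_system (R : realType) (X : metricType R) (G : zmodType)
    (act : G -> X -> X) : Prop := DynamicalSystem {
  ds_compact : compact [set: X] ;
  ds_act0 : forall x, act 0 x = x ;
  ds_actD : forall g h x, act (g + h) x = act g (act h x) ;
  ds_continuous : forall g, continuous (act g) }.

Definition minimal (R : realType) (X : metricType R) (G : zmodType)
    (act : G -> X -> X) : Prop :=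
  forall x : X, dense [set act g x | g in [set: G]].

Definition enveloping_semigroup (R : realType) (X : metricType R)
    (G : zmodType) (act : G -> X -> X) : set {ptws X -> X} :=
  closure [set (act g : {ptws X -> X}) | g in [set: G]].

(* Groups of self-maps under composition. The neutral element is required to be
   the identity map; an enveloping semigroup always contains it, as [act 0]. *)
Record composition_group (T : Type) (S : set (T -> T)) : Prop :=
  CompositionGroup {
  cg_id : S id ;
  cg_comp : forall a b, S a -> S b -> S (a \o b) ;
  cg_inv : forall a, S a -> exists a', [/\ S a', cancel a a' & cancel a' a] }.

(* The maps a b a^-1 b^-1; [cancel] in both directions determines the inverses
   a' and b'. *)
Definition commutators (T : Type) (A B : set (T -> T)) : set (T -> T) :=
  [set c | exists a a' b b' : T -> T,
    [/\ A a, B b, cancel a a' /\ cancel a' a, cancel b b' /\ cancel b' b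
      & c = a \o b \o a' \o b']].

(* When A and B lie in a composition group E, the smallest composition group
   containing the commutators is the subgroup of E that they generate. *)
Definition commutator_subgroup (T : Type) (A B : set (T -> T)) :
    set (T -> T) :=
  smallest (@composition_group T) (commutators A B).

(* Numbered from 0: [top_lower_central E j] is E_{j+1}^top. *)
Fixpoint top_lower_central (X : topologicalType) (E : set {ptws X -> X})
    (j : nat) : set {ptws X -> X} :=
  if j is i.+1 then
    closure (commutator_subgroup (top_lower_central E i) E : set {ptws X -> X})
  else E.

Definition step_top_nilpotent (X : topologicalType) (d : nat)
    (E : set {ptws X -> X}) : Prop :=
  top_lower_central E d = [set id].

Definition top_nilpotent_group (X : topologicalType) (E : set {ptws X -> X}) :
    Prop :=
  composition_group E /\ exists d : nat, step_top_nilpotent d E.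

Definition RP (R : realType) (X : metricType R) (G : zmodType)
    (act : G -> X -> X) (d : nat) : set (X * X) :=
  [set p | forall delta : R, 0 < delta ->
    exists (x' y' : X) (g : {ffun 'I_d -> G}),
      [/\ mdist p.1 x' < delta, mdist p.2 y' < delta
        & forall eps : {ffun 'I_d -> bool}, eps <> [ffun=> false] ->
            let h := \sum_(i < d) g i *+ eps i in
            mdist (act h x') (act h y') < delta]].

Definition RP_infty (R : realType) (X : metricType R) (G : zmodType)
    (act : G -> X -> X) : set (X * X) :=
  \bigcap_(d in [set d | (1 <= d)%N]) RP act d.

Definition system_of_order_infty (R : realType) (X : metricType R)
    (G : zmodType) (act : G -> X -> X) : Prop :=
  RP_infty act = [set (x, x) | x in [set: X]].

(* Main.v *)
Require Import Defs.
From mathcomp Require Import all_boot all_order all_algebra.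
From mathcomp Require Import all_classical all_reals.
From mathcomp Require Import topology.
From HB Require Import structures.

(** Let [Q_k] be the closure of the [k]-dimensional cubes, so that [Q_(k+1)] is
    the closure of the pairs [(c, g c)] with [c] in [Q_k].  By Baire, for a generic
    [c] in [Q_k] every [c'] with [(c, c')] in [Q_(k+1)] lies in the closure of the
    diagonal orbit of [c], i.e. [c' = p c] for some [p] in [E(X)]; one may ask this
    of the lower faces of [c] as well, so that its upper faces are images of its
    lower faces under elements [q_i] of [E(X)].

    If [(x, y)] is in [RP^[d]], compactness gives [(a, b)] in [Q_(d+1)] with [a] and
    [b] equal off vertex 0, where they are [x] and [y].  As [E(X)] is a group, Ellis'
    lemma makes the closed semigroup of those [F] in [E(X)^(2^d)] with [(F, F)]
    preserving [Q_(d+1)] a group; it contains the Host-Kra group, hence is transitive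
    on [Q_d], and [a] can be moved to a generic [c].  The resulting pair
    is [(c, p c)] with [p] in [E(X)] fixing every vertex of [c] but vertex 0, and the
    iterated commutator of [p] with the [q_i^-1] acts on vertex 0 as [p].  When
    [E(X)] is [d]-step nilpotent it is the identity, hence [x = y]; so already
    [RP^[d]] is trivial. *)

Set Implicit Arguments.
Unset Strict Implicit.
Unset Printing Implicit Defensive.

Import Order.TTheory GRing.Theory Num.Theory.
Local Open Scope classical_set_scope.

(** * Compactness, and idempotents in compact semigroups *)

Lemma compact_directed_bigcap (T : topologicalType) (A : set T) (I : Type)
    (D : set I) (f : I -> set T) :
  compact A -> D !=set0 ->
  (forall i, D i -> [/\ closed (f i), f i `<=` A & f i !=set0]) ->
  (forall i j, D i -> D j -> exists2 k, D k & f k `<=` f i `&` f j) ->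
  \bigcap_(i in D) f i !=set0.
Proof.
move=> Aco [i0 Di0] Df dirf.
have FF : ProperFilter (filter_from D f).
  apply: filter_from_proper; last by move=> i /Df[].
  by apply: filter_from_filter; first exists i0.
have [|p [Ap clp]] := Aco _ FF.
  by exists i0 => //; have [] := Df _ Di0.
exists p => i Di; have [cfi _ _] := Df _ Di; apply: cfi => B pB.
by apply: clp => //; exists i.
Qed.

(** Every element [a] of a minimal closed subsemigroup [M] is idempotent: minimality gives
    [M a = M], so the closed semigroup of those [m] in [M] with [m a = a] is nonempty, hence equals
    [M] and contains [a]. Continuity is asked in the left factor only, as for composition under
    pointwise convergence. *)
Lemma ellis_idempotent (T : topologicalType) (mul : T -> T -> T) (S : set T) :
  hausdorff_space T -> compact S -> S !=set0 ->
  associative mul -> (forall b, continuous (mul^~ b)) ->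
  (forall a b, S a -> S b -> S (mul a b)) ->
  exists2 e, S e & mul e e = e.
Proof.
move=> hT cS S0 mulA mulc mulS.
have clS : closed S by exact: compact_closed.
pose sg (M : set T) := [/\ closed M, M !=set0 &
  forall a b, M a -> M b -> M (mul a b)].
(* Zorn is applied to the sets [A] removed from [S]: their unions along chains correspond to
   intersections of subsemigroups. *)
have [A [sA Amax]] :
    exists A, sg (S `\` A) /\ forall B, A `<` B -> ~ sg (S `\` B).
  apply: (@Zorn_bigcup _ (fun A => sg (S `\` A))) => F FP Ftot.
  have [[A0 FA0]|F0] := pselect (F !=set0); last first.
    rewrite (_ : \bigcup_(X in F) X = set0) ?setD0; first by split.
    by rewrite -subset0 => x [X FX _]; apply: F0; exists X.
  rewrite (_ : S `\` _ = \bigcap_(X in F) (S `\` X)); last first.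
    apply/seteqP; split=> [x [Sx nx] X FX|x Fx].
      by split=> // Xx; apply: nx; exists X.
    split; first by have [] := Fx _ FA0.
    by move=> [X FX Xx]; have [_] := Fx _ FX; apply.
  split.
  - by apply: closed_bigI => X FX; have [] := FP _ FX.
  - apply: (compact_directed_bigcap cS); first by exists A0.
      by move=> X /FP[cX X0 _]; split=> //; exact: subDsetl.
    move=> X Y FX FY; have [XY|YX] := Ftot _ _ FX FY.
      by exists Y => // x [Sx nYx]; split; split=> // /XY.
    by exists X => // x [Sx nXx]; split; split=> // /YX.
  - move=> a b Fa Fb X FX; have [_ _ XM] := FP _ FX.
    by apply: XM; [exact: Fa | exact: Fb].
set M := S `\` A in sA; case: (sA) => cM [a Ma] mulM.
have MS : M `<=` S by exact: subDsetl.
have Mmin N : N `<=` M -> sg N -> N = M.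
  move=> NM sN; apply/seteqP; split=> // x Mx; apply: contrapT => nNx.
  have SN : S `\` ~` N = N by rewrite setDE setCK; apply/setIidr/(subset_trans NM).
  apply: (Amax (~` N)); last by rewrite SN.
  split; first by move=> y Ay /NM[_].
  by move=> /(_ _ nNx); case: Mx => _; apply.
have compM : compact M by exact: subclosed_compact cM cS MS.
have Ma_eq : mul^~ a @` M = M.
  apply: Mmin; first by move=> _ [m Mm <-]; exact: mulM.
  split.
  - apply: compact_closed => //; apply: continuous_compact => //.
    exact: continuous_subspaceT.
  - by exists (mul a a); exists a.
  - move=> _ _ [m Mm <-] [n Mn <-]; exists (mul (mul m a) n); last by rewrite mulA.
    by apply: (mulM) => //; exact: mulM.
pose N := M `&` (mul^~ a @^-1` [set a]).
have NM : N = M.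
  apply: Mmin; first exact: subIsetl.
  split.
  - apply: closedI => //; apply: preimage_closed.
      by move=> x _; exact: mulc.
    exact/accessible_closed_set1/hausdorff_accessible.
  - by have : M a by []; rewrite -{1}Ma_eq => -[t Mt ta]; exists t.
  - move=> x y [Mx xa] [My ya]; split; first exact: mulM.
    by rewrite /= -mulA ya.
by exists a; [exact: MS | have : M a by []; rewrite -NM => -[]].
Qed.

(** * Baire category in a compact subset *)

(** Comeagerness relative to [Q], with open sets of the ambient space; as any countable index type
    is allowed, two families are joined by a sum. *)
Definition residual (T : topologicalType) (Q A : set T) : Prop :=
  exists (I : countType) (F : I -> set T),
    [/\ forall i, open (F i),
        forall i V, open V -> Q `&` V !=set0 -> Q `&` V `&` F i !=set0
      & forall x, Q x -> (forall i, F i x) -> A x].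

Lemma residualS (T : topologicalType) (Q A B : set T) :
  A `<=` B -> residual Q A -> residual Q B.
Proof.
by move=> AB [I [F [oF dF FA]]]; exists I, F; split=> // x Qx /(FA _ Qx)/AB.
Qed.

Lemma residualI (T : topologicalType) (Q A B : set T) :
  residual Q A -> residual Q B -> residual Q (A `&` B).
Proof.
move=> [I [F [oF dF FA]]] [J [H [oH dH HB]]].
exists (I + J)%type, (fun k => match k with inl i => F i | inr j => H j end).
split=> [[i|j]|[i|j]|x Qx FHx] //.
- exact: dF.
- exact: dH.
- split; [apply: FA => // i; exact: (FHx (inl i))|].
  by apply: HB => // j; exact: (FHx (inr j)).
Qed.

(** Baire's argument: open sets [V n] meeting [Q] are chosen with the closure of [V n.+1] inside
    [V n] and the [n]-th dense open set; compactness gives a point of [Q] in all the closures. *)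
Lemma residual_ex (T : topologicalType) (Q A : set T) :
  hausdorff_space T -> compact [set: T] -> closed Q -> Q !=set0 ->
  residual Q A -> Q `&` A !=set0.
Proof.
move=> hT cT cQ Q0 [I [F [oF dF FA]]].
have cptQ : compact Q by exact: subclosed_compact cQ cT _.
have regT (x : T) : regular_space T by move=> a; exact: (compact_regular hT cT filterT).
(* Numbers that code no index impose no condition. *)
pose G n : set T := if unpickle n is Some i then F i else setT.
(* The conditions on [V] stand under the existential, so that choice yields a total function
   [nxt]. *)
have step n (V : set T) : exists W : set T, open V -> Q `&` V !=set0 ->
    [/\ open W, Q `&` W !=set0 & closure W `<=` V `&` G n].
  have [[oV QV]|h] := pselect (open V /\ Q `&` V !=set0); last first.
    by exists set0 => oV QV; exfalso; apply: h.
  have oG : open (G n) by rewrite /G; case: unpickle => [i|]; [|exact: openT].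
  have [x [[Qx Vx] Gx]] : Q `&` V `&` G n !=set0.
    rewrite /G; case: unpickle => [i|]; first exact: dF.
    by rewrite setIT.
  have : nbhs x (V `&` G n) by apply: open_nbhs_nbhs; split=> //; exact: openI.
  move=> /(regT x x)[U xU UVG].
  exists U° => _ _; split; first exact: open_interior.
    by exists x; split.
  by apply: subset_trans UVG; apply: closureS; exact: interior_subset.
pose nxt n V := projT1 (cid (step n V)).
have nxtP n V : open V -> Q `&` V !=set0 ->
    [/\ open (nxt n V), Q `&` nxt n V !=set0 & closure (nxt n V) `<=` V `&` G n].
  exact: projT2 (cid (step n V)).
pose V := fix V n := if n is m.+1 then nxt m (V m) else [set: T].
have VP n : open (V n) /\ Q `&` V n !=set0.
  elim: n => [|n [oV QV]] /=; first by rewrite setIT; split=> //; exact: openT.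
  by have [] := nxtP n _ oV QV.
have Vdec n : closure (V n.+1) `<=` V n `&` G n.
  by have [oV QV] := VP n; have [] := nxtP n _ oV QV.
have Vmono m n : (m <= n)%N -> V n `<=` V m.
  move=> /subnK <-; elim: (n - m)%N => // k IH x.
  by rewrite addSn => /subset_closure/Vdec[/IH].
have [x Vx] : \bigcap_(n in [set: nat]) (Q `&` closure (V n)) !=set0.
  apply: (compact_directed_bigcap cptQ); first by exists 0%N.
    move=> n _; split; first by apply: closedI => //; exact: closed_closure.
      exact: subIsetl.
    have [_ [y [Qy Vy]]] := VP n; exists y; split=> //; exact: subset_closure.
  move=> m n _ _; exists (maxn m n) => // y [Qy Vy].
  by split; split=> //; apply: closureS Vy; apply: Vmono;
    [exact: leq_maxl | exact: leq_maxr].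
have Qx : Q x by have [] := Vx 0%N Logic.I.
exists x; split=> //; apply: FA => // i.
have [_ /Vdec[_]] := Vx (pickle i).+1 Logic.I.
by rewrite /G pickleK.
Qed.

Definition countable_base (T : topologicalType) : Prop :=
  exists (I : countType) (B : I -> set T), (forall i, open (B i)) /\
    forall x V, nbhs x V -> exists i, B i x /\ B i `<=` V.

Lemma nbhs_setX (T U : topologicalType) (x : T) (y : U) (A : set T) (B : set U) :
  nbhs x A -> nbhs y B -> nbhs (x, y) (A `*` B).
Proof. by move=> xA yB; exists (A, B). Qed.

Lemma countable_base_prod (T U : topologicalType) :
  countable_base T -> countable_base U -> countable_base (T * U)%type.
Proof.
move=> [I [B [oB BP]]] [J [C [oC CP]]].
exists (I * J)%type, (fun k => B k.1 `*` C k.2); split.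
  move=> [i j]; rewrite openE => -[x y] [/= Bx Cy].
  by apply: nbhs_setX; apply: open_nbhs_nbhs; split.
move=> [x y] V [[V1 V2] /= [xV1 yV2] V12].
have [i [Bx BV]] := BP _ _ xV1; have [j [Cy CV]] := CP _ _ yV2.
by exists (i, j); split=> // -[a b] [/= /BV ? /CV ?]; apply: V12.
Qed.

Lemma countable_base_compact (R : realType) (X : pseudoMetricType R) (x0 : X) :
  compact [set: X] -> countable_base X.
Proof.
pose pX := HB.pack_for (pseudoPMetricType R) X (isPointed.Build X x0).
move=> /(@compact_second_countable R pX)[B /countable_injP[f finj] [oB BP]].
(* As [f] is injective on [B], the union has at most one member, the base set numbered [n]. *)
exists nat, (fun n => \bigcup_(A in [set A | B A /\ f A = n]) A); split.
  by move=> n; apply: bigcup_open => A [BA _]; exact: oB.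
move=> x V /BP[A [BA Ax] AV]; exists (f A); split; first by exists A.
move=> y [A' [BA' ff] A'y]; apply: AV.
by rewrite -(finj A' A) ?inE.
Qed.

(** For a basic open [B i], let [O i] be the set of points whose orbit meets it. The open set [O i]
    together with the exterior of [Q] meet [O i] is dense in [Q]. If [c] lies in all of these and
    [c'] is in [B i], then [c] is in [O i]: otherwise a neighbourhood of [c] contains no point of
    [Q] with orbit meeting [B i], and [(c, c')] is not a limit. *)
Lemma residual_orbit_closure (T : topologicalType) (G : Type) (t : G -> T -> T)
    (Q : set T) :
  countable_base T -> (forall g, continuous (t g)) ->
  residual Q [set c | forall c',
    closure [set (c1, t g c1) | c1 in Q & g in [set: G]] (c, c') ->
    closure [set t g c | g in [set: G]] c'].
Proof.
move=> [I [B [oB BP]]] ct.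
pose O i := \bigcup_(g in [set: G]) (t g @^-1` B i).
have oO i : open (O i).
  by apply: bigcup_open => g _; apply: open_comp => // x _; exact: ct.
exists I, (fun i => O i `|` ~` closure (Q `&` O i)); split.
- by move=> i; apply: openU => //; exact/closed_openC/closed_closure.
- move=> i V oV [v [Qv Vv]].
  have [cl|ncl] := pselect (closure (Q `&` O i) v); last first.
    by exists v; split=> //; right.
  have [w [[Qw Ow] Vw]] := cl _ (open_nbhs_nbhs (conj oV Vv)).
  by exists w; split=> //; left.
- move=> c Qc Fc c' cc' V c'V.
  have [i [Bc' BV]] := BP _ _ c'V.
  have [[g _ Bg]|ncl] := Fc i.
    by exists (t g c); split; [exists g | exact: BV].
  have oW : open (~` closure (Q `&` O i)) by exact/closed_openC/closed_closure.
  have [|[_ _] [[c1 Qc1 [g _ [<- <-]]] [/= ncl1 Bg]]] :=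
    cc' (~` closure (Q `&` O i) `*` B i).
    by apply: nbhs_setX; apply: open_nbhs_nbhs; split; rewrite //; exact: oB.
  by case: ncl1; apply: subset_closure; split=> //; exists g.
Qed.

(** * Continuity and closed sets in products *)

Lemma continuous_pair (S T U : topologicalType) (f : S -> T) (g : S -> U) :
  continuous f -> continuous g -> continuous (fun x => (f x, g x)).
Proof. by move=> cf cg x; apply: cvg_pair; [exact: cf | exact: cg]. Qed.

Lemma continuous_comp_fun (S T U : topologicalType) (f : S -> T) (g : T -> U) :
  continuous f -> continuous g -> continuous (fun x => g (f x)).
Proof. by move=> cf cg x; apply: continuous_comp; [exact: cf | exact: cg]. Qed.

Lemma continuous_fst (T U : topologicalType) : continuous (@fst T U).
Proof. by move=> x; exact: cvg_fst. Qed.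

Lemma continuous_snd (T U : topologicalType) : continuous (@snd T U).
Proof. by move=> x; exact: cvg_snd. Qed.

Lemma hausdorff_prod (T U : topologicalType) :
  hausdorff_space T -> hausdorff_space U -> hausdorff_space (T * U)%type.
Proof.
move=> hT hU [a b] [c d] cl; congr pair.
- apply: hT => A B aA cB.
  have [[x y] [[Ax _] [Bx _]]] := cl _ _ (nbhs_setX aA filterT) (nbhs_setX cB filterT).
  by exists x.
- apply: hU => A B bA dB.
  have [[x y] [[_ Ay] [_ By]]] := cl _ _ (nbhs_setX filterT bA) (nbhs_setX filterT dB).
  by exists y.
Qed.

Lemma closed_eq_continuous (S T : topologicalType) (f g : S -> T) :
  hausdorff_space T -> continuous f -> continuous g ->
  closed [set x | f x = g x].
Proof.
move=> hT cf cg x clx; apply: hT => A B fA gB.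
have xA : nbhs x (f @^-1` A) := cf _ _ fA.
have xB : nbhs x (g @^-1` B) := cg _ _ gB.
have [y [fgy [Ay By]]] := clx _ (filterI xA xB).
by exists (f y); split=> //; rewrite fgy.
Qed.

Lemma closure_sub_closed (T : topologicalType) (A B : set T) :
  closed B -> A `<=` B -> closure A `<=` B.
Proof. by move=> cB AB; apply: subset_trans cB; exact: closureS. Qed.

Lemma closed_preimage (S T : topologicalType) (f : S -> T) (A : set T) :
  continuous f -> closed A -> closed (f @^-1` A).
Proof. by move=> cf; apply: preimage_closed => x _; exact: cf. Qed.

(** * Cubes *)

(** A [2^k]-tuple as nested pairs, lower face first; topology and induction on the dimension then
    come from binary products. *)
Fixpoint cube (T : topologicalType) (k : nat) : topologicalType :=
  if k is m.+1 then (cube T m * cube T m)%type else T.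

Fixpoint cube_const (T : topologicalType) (x : T) k : cube T k :=
  if k is m.+1 then (cube_const x m, cube_const x m) else x.

Fixpoint cube_map2 (S T U : topologicalType) (f : S -> T -> U) k :
    cube S k -> cube T k -> cube U k :=
  if k is m.+1 then fun a b => (cube_map2 f a.1 b.1, cube_map2 f a.2 b.2)
  else f.

Fixpoint cube_all (T : topologicalType) (A : set T) k : set (cube T k) :=
  if k is m.+1 then cube_all A (k := m) `*` cube_all A (k := m) else A.

Fixpoint cube0 (T : topologicalType) k : cube T k -> T :=
  if k is m.+1 then fun c => cube0 c.1 else id.

Fixpoint cube_rel (T : topologicalType) (r : T -> T -> Prop) k :
    cube T k -> cube T k -> Prop :=
  if k is m.+1 then fun a b => cube_rel r a.1 b.1 /\ cube_rel r a.2 b.2 else r.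

(** Vertex 0 lies on every lower face, so upper faces are compared in full. *)
Fixpoint cube_rel_off0 (T : topologicalType) (r : T -> T -> Prop) k :
    cube T k -> cube T k -> Prop :=
  if k is m.+1 then fun a b => cube_rel_off0 r a.1 b.1 /\ cube_rel r a.2 b.2
  else fun _ _ => True.

Lemma hausdorff_cube (T : topologicalType) k :
  hausdorff_space T -> hausdorff_space (cube T k).
Proof. by move=> hT; elim: k => //= k IH; exact: hausdorff_prod. Qed.

Lemma compact_cube_all (T : topologicalType) (A : set T) k :
  compact A -> compact (cube_all A (k := k)).
Proof. by move=> cA; elim: k => //= k IH; exact: compact_setX. Qed.

Lemma cube_allT (T : topologicalType) k : cube_all [set: T] (k := k) = setT.
Proof. by elim: k => //= k ->; rewrite setXTT. Qed.

Lemma countable_base_cube (T : topologicalType) k :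
  countable_base T -> countable_base (cube T k).
Proof. by move=> hT; elim: k => //= k IH; exact: countable_base_prod. Qed.

Lemma continuous_cube_const (T : topologicalType) k :
  continuous (fun x : T => cube_const x k).
Proof.
elim: k => [|k IH] /=; first by move=> x; exact: cvg_id.
exact: continuous_pair.
Qed.

Lemma continuous_cube0 (T : topologicalType) k : continuous (@cube0 T k).
Proof.
elim: k => [|k IH] /=; first by move=> x; exact: cvg_id.
exact: (continuous_comp_fun (@continuous_fst _ _) IH).
Qed.

Lemma continuous_cube_map2l (S T U : topologicalType) (f : S -> T -> U) k
    (b : cube T k) :
  (forall y, continuous (f^~ y)) -> continuous (fun a => cube_map2 f a b).
Proof.
move=> cf; elim: k b => [|k IH] b /=; first exact: cf.
apply: continuous_pair.
  exact: (continuous_comp_fun (@continuous_fst _ _) (IH b.1)).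
exact: (continuous_comp_fun (@continuous_snd _ _) (IH b.2)).
Qed.

(** Elements of [E(X)] may be discontinuous, so continuity in the point needs a hypothesis at each
    vertex. *)
Lemma continuous_cube_map2r (S T U : topologicalType) (f : S -> T -> U) k
    (a : cube S k) :
  cube_all [set x | continuous (f x)] a -> continuous (cube_map2 f a).
Proof.
elim: k a => [|k IH] a /=; first by [].
move=> [a1 a2]; apply: continuous_pair.
  exact: (continuous_comp_fun (@continuous_fst _ _) (IH _ a1)).
exact: (continuous_comp_fun (@continuous_snd _ _) (IH _ a2)).
Qed.

Lemma cube_all_const (T : topologicalType) (A : set T) k x :
  A x -> cube_all A (cube_const x k).
Proof. by move=> Ax; elim: k. Qed.

Lemma cube_allS (T : topologicalType) (A B : set T) k (c : cube T k) :
  A `<=` B -> cube_all A c -> cube_all B c.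
Proof.
move=> AB; elim: k c => [|k IH] c; first exact: AB.
by move=> [c1 c2]; split; exact: IH.
Qed.

Lemma cube_all_map2 (S T U : topologicalType) (f : S -> T -> U)
    (A : set S) (B : set T) (C : set U) k (a : cube S k) (b : cube T k) :
  (forall x y, A x -> B y -> C (f x y)) ->
  cube_all A a -> cube_all B b -> cube_all C (cube_map2 f a b).
Proof.
move=> fC; elim: k a b => [|k IH] a b; first exact: fC.
by move=> [a1 a2] [b1 b2]; split; exact: IH.
Qed.

Lemma cube_relW (T : topologicalType) (r s : T -> T -> Prop) k
    (a b : cube T k) :
  (forall x y, r x y -> s x y) -> cube_rel r a b -> cube_rel s a b.
Proof.
move=> rs; elim: k a b => [|k IH] a b; first exact: rs.
by move=> [r1 r2]; split; exact: IH.
Qed.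

Lemma cube_rel_off0W (T : topologicalType) (r s : T -> T -> Prop) k
    (a b : cube T k) :
  (forall x y, r x y -> s x y) -> cube_rel_off0 r a b -> cube_rel_off0 s a b.
Proof.
move=> rs; elim: k a b => [|k IH] a b //.
by move=> [r1 r2]; split; [exact: IH | exact: cube_relW r2].
Qed.

Lemma cube_rel_refl (T : topologicalType) (r : T -> T -> Prop) k (a : cube T k) :
  (forall x, r x x) -> cube_rel r a a.
Proof. by move=> rr; elim: k a => //= k IH a; split. Qed.

Lemma cube_rel_eq (T : topologicalType) k (a b : cube T k) :
  cube_rel eq a b -> a = b.
Proof.
elim: k a b => [|k IH] a b //; case: a b => a1 a2 [b1 b2] [/= /IH -> /IH ->].
by [].
Qed.

Lemma cube0_map2 (S T U : topologicalType) (f : S -> T -> U) k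
    (a : cube S k) (b : cube T k) :
  cube0 (cube_map2 f a b) = f (cube0 a) (cube0 b).
Proof. by elim: k a b => //= k IH a b; rewrite IH. Qed.

Lemma cube_all_cube0 (T : topologicalType) (A : set T) k (c : cube T k) :
  cube_all A c -> A (cube0 c).
Proof. by elim: k c => //= k IH c [/IH]. Qed.

(** * Pointwise convergence *)

Definition ptws_app (X : topologicalType) (p : {ptws X -> X}) (x : X) : X := p x.

Definition ptws_comp (X : topologicalType) (p q : {ptws X -> X}) : {ptws X -> X} :=
  p \o q.

Lemma continuous_ptws_app (X : topologicalType) (x : X) :
  continuous ((@ptws_app X)^~ x).
Proof. exact: (@proj_continuous _ (fun=> X) x). Qed.

(** Evaluating the composite at [x] is evaluating the left factor at [q x], which is a coordinate
    projection. *)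
Lemma continuous_ptws_comp (X : topologicalType) (q : {ptws X -> X}) :
  continuous ((@ptws_comp X)^~ q).
Proof.
move=> p.
have FF : Filter (ptws_comp r q @[r --> p]).
  by apply: (@fmap_filter _ _ _ _ (nbhs_filter p)).
apply/cvg_sup => x U [V] [[W] oW <-] Wpx WU; rewrite nbhs_simpl.
have pW : nbhs p [set r | W (r (q x))].
  exact: (@continuous_ptws_app X (q x) p _ (open_nbhs_nbhs (conj oW Wpx))).
have sub : [set r | W (r (q x))] `<=` [set r | U (ptws_comp r q)].
  by move=> r Wr; apply: WU.
change (nbhs p [set r | U (ptws_comp r q)]).
exact (@filterS _ _ (nbhs_filter p) _ _ sub pW).
Qed.

Lemma hausdorff_ptws (X : topologicalType) :
  hausdorff_space X -> hausdorff_space {ptws X -> X}.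
Proof.
by move=> hX; apply: (@hausdorff_product {classic X} (fun=> X)) => _.
Qed.

Lemma compact_ptws (X : topologicalType) :
  compact [set: X] -> compact [set: {ptws X -> X}].
Proof.
move=> cX; have := @tychonoff {classic X} (fun=> X) (fun=> setT) (fun=> cX).
by congr (compact _); apply/seteqP.
Qed.

Notation "F *@ c" := (cube_map2 (@ptws_app _) F c) (at level 40).
Notation "F *o H" := (cube_map2 (@ptws_comp _) F H) (at level 40).
Notation cubeP X k := (cube {ptws X -> X} k).

Lemma cube_appA (X : topologicalType) k (F H : cubeP X k) (c : cube X k) :
  (F *o H) *@ c = F *@ (H *@ c).
Proof. by elim: k F H c => //= k IH F H c; rewrite !IH. Qed.

Lemma cube_compA (X : topologicalType) k :
  associative (@cube_map2 _ _ _ (@ptws_comp X) k).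
Proof. by elim: k => //= k IH F H L; rewrite !IH. Qed.

Lemma cube_app_id (X : topologicalType) k (c : cube X k) :
  @cube_const {ptws X -> X} id k *@ c = c.
Proof. by elim: k c => //= k IH [c1 c2]; rewrite !IH. Qed.

Lemma cube_app_constA (X : topologicalType) k (p q : {ptws X -> X})
    (c : cube X k) :
  cube_const p k *@ (cube_const q k *@ c) = cube_const (ptws_comp p q) k *@ c.
Proof. by elim: k c => //= k IH [c1 c2]; rewrite !IH. Qed.

Lemma cube_rel_off0_app (X : topologicalType) k (F : cubeP X k)
    (a b : cube X k) :
  cube_rel_off0 eq a b -> cube_rel_off0 eq (F *@ a) (F *@ b).
Proof.
elim: k F a b => //= k IH F [a1 a2] [b1 b2] /= [ab1 /cube_rel_eq ->].
split; first exact: IH.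
exact: cube_rel_refl.
Qed.

(** * Dynamical cubes *)

Section DynamicalCubes.
Context (R : realType) (X : metricType R) (G : zmodType) (act : G -> X -> X).
Hypothesis sys : dynamical_system act.

Let pact (g : G) : {ptws X -> X} := act g.
Let E : set {ptws X -> X} := enveloping_semigroup act.

Definition cube_act k (g : G) (c : cube X k) : cube X k :=
  cube_const (act g : {ptws X -> X}) k *@ c.

Fixpoint dyn_cube k : set (cube X k) :=
  if k is m.+1 then closure [set (c, cube_act g c) | c in @dyn_cube m & g in [set: G]]
  else setT.

(* The Host-Kra group of [G], as tuples of translations indexed by the vertices. *)
Fixpoint host_kra k : set (cubeP X k) :=
  if k is m.+1 then
    [set (F, F *o cube_const (act g : {ptws X -> X}) m) |
       F in @host_kra m & g in [set: G]]
  else range pact.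

Let hX : hausdorff_space X. Proof. exact: metric_hausdorff. Qed.

Lemma pact0 : pact 0 = id :> {ptws X -> X}.
Proof. by apply/funext => x; exact: (ds_act0 sys). Qed.

Lemma pactD g h : ptws_comp (pact g) (pact h) = pact (g + h)%R.
Proof. by apply/funext => x; rewrite /pact /ptws_comp /= (ds_actD sys). Qed.

Lemma cube_act_id k (c : cube X k) : cube_act 0 c = c.
Proof. by rewrite /cube_act [X in cube_const X]pact0 cube_app_id. Qed.

Lemma cube_actD k g h (c : cube X k) :
  cube_act (g + h)%R c = cube_act g (cube_act h c).
Proof. by rewrite /cube_act cube_app_constA -[act (g + h)%R]pactD. Qed.

Lemma continuous_cube_act k g : continuous (@cube_act k g).
Proof.
apply: continuous_cube_map2r; apply: cube_all_const; exact: (ds_continuous sys).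
Qed.

Lemma env_act g : E (pact g).
Proof. by apply: subset_closure; exists g. Qed.

Lemma env_closed : closed E. Proof. exact: closed_closure. Qed.

Lemma env_compact : compact E.
Proof.
apply: (subclosed_compact env_closed (compact_ptws (ds_compact sys))).
exact: subsetT.
Qed.

(** True of translations because [G] is abelian, and a closed condition on [p] because [act g] is
    continuous. *)
Lemma env_commute p g x : E p -> p (act g x) = act g (p x).
Proof.
suff cl : E `<=` [set p | p (act g x) = act g (p x)] by move=> /cl.
rewrite /E /enveloping_semigroup; apply: closure_sub_closed.
  apply: (@closed_eq_continuous _ _ ((@ptws_app X)^~ (act g x))
    (fun p => act g (ptws_app p x))) => //.
    exact: continuous_ptws_app.
  apply: (continuous_comp_fun (@continuous_ptws_app X x)).
  exact: (@ds_continuous _ _ _ _ sys g).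
by move=> _ [h _ <-] /=; rewrite -!(ds_actD sys) addrC.
Qed.

Lemma cube_act_commute k (F : cubeP X k) g c :
  cube_all E F -> F *@ cube_act g c = cube_act g (F *@ c).
Proof.
elim: k F c => [|k IH] F c /=; first exact: env_commute.
by move=> [F1 F2]; congr pair; exact: IH.
Qed.

Lemma dyn_cube_closed k : closed (@dyn_cube k).
Proof. by case: k => [|k]; [exact: closedT | exact: closed_closure]. Qed.

Lemma dyn_cube_pair k c g : @dyn_cube k c -> @dyn_cube k.+1 (c, cube_act g c).
Proof. by move=> Qc; apply: subset_closure; exists c => //; exists g. Qed.

Lemma dyn_cubeS_fst k c : @dyn_cube k.+1 c -> @dyn_cube k c.1.
Proof.
move: c; apply: closure_sub_closed.
  apply: (closed_preimage (@continuous_fst _ _)); exact: dyn_cube_closed.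
by move=> _ [c Qc [g _ <-]].
Qed.

(** The pairs [(c, g c)] are dense in [Q_(k+1)], and by continuity [c] can be moved slightly within
    [Q_k] into a dense open set. *)
Lemma residual_fst k (A : set (cube X k)) :
  residual (@dyn_cube k) A -> residual (@dyn_cube k.+1) [set c | A c.1].
Proof.
move=> [I [F [oF dF FA]]]; exists I, (fun i => fst @^-1` F i); split.
- by move=> i; apply: open_comp => // x _; exact: continuous_fst.
- move=> i V oV [v [Qv Vv]].
  have [_ [[c Qc [g _ <-]] Vc]] := Qv _ (open_nbhs_nbhs (conj oV Vv)).
  pose W := (fun c => (c, cube_act g c)) @^-1` V.
  have oW : open W.
    apply: open_comp => // x _.
    apply: continuous_pair; first by move=> ?; exact: cvg_id.
    exact: continuous_cube_act.
  have [c' [[Qc' Wc'] Fc']] := dF i W oW (ex_intro _ c (conj Qc Vc)).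
  by exists (c', cube_act g c'); split=> //; split=> //; exact: dyn_cube_pair.
- by move=> x /dyn_cubeS_fst Qx Fx; apply: FA.
Qed.

Lemma cube_all_env_closed k : closed (cube_all E (k := k)).
Proof.
apply: compact_closed; last exact/compact_cube_all/env_compact.
exact/hausdorff_cube/hausdorff_ptws.
Qed.

(** The image of the compact [E] under [p |-> p c] is closed and contains the diagonal orbit of
    [c]. *)
Lemma env_orbit_closure k (c c' : cube X k) :
  closure [set cube_act g c | g in [set: G]] c' ->
  exists2 p, E p & c' = cube_const p k *@ c.
Proof.
have cO : closed ((fun p => cube_const p k *@ c) @` E).
  apply: compact_closed; first exact: hausdorff_cube.
  apply: continuous_compact; last exact: env_compact.
  apply: continuous_subspaceT.
  apply: (continuous_comp_fun (@continuous_cube_const _ k) (g := fun F => F *@ c)).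
  by apply: continuous_cube_map2l; exact: continuous_ptws_app.
move=> cl; have [|p Ep <-] := closure_sub_closed cO _ cl; last by exists p.
by move=> _ [g _ <-]; exists (pact g) => //; exact: env_act.
Qed.

Lemma host_kra_env k F : @host_kra k F -> cube_all (range pact) F.
Proof.
elim: k F => [|k IH] F //= [F1 /IH aF1 [g _ <-]]; split=> //=.
apply: (cube_all_map2 _ aF1 (cube_all_const k (A := range pact) _)).
  by move=> _ _ [a _ <-] [b _ <-]; exists (a + b)%R => //; rewrite pactD.
by exists g.
Qed.

Lemma range_pact_env : range pact `<=` E.
Proof. exact: subset_closure. Qed.

Lemma host_kra_continuous k F :
  @host_kra k F -> continuous (fun c : cube X k => F *@ c).
Proof.
move=> /host_kra_env aF; apply: continuous_cube_map2r.
by apply: cube_allS aF => _ [g _ <-]; exact: (ds_continuous sys).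
Qed.

(** On a pair [(c, h c)] the lower tuple commutes with the diagonal action, so the image is again of
    this form, with [g + h]. Continuity of translations extends this to the closure. *)
Lemma host_kra_dyn_cube k F c :
  @host_kra k F -> dyn_cube c -> dyn_cube (F *@ c).
Proof.
elim: k F c => [|k IH] F c //= [F1 HF1 [g _ <-]].
have HF : @host_kra k.+1 (F1, F1 *o cube_const (act g : {ptws X -> X}) k).
  by exists F1 => //; exists g.
move: c; apply: closure_sub_closed.
  apply: (closed_preimage (host_kra_continuous HF)); exact: dyn_cube_closed.
move=> _ [c Qc [h _ <-]]; rewrite /preimage /= cube_appA.
rewrite -[cube_const _ _ *@ cube_act h c]/(cube_act g (cube_act h c)).
rewrite -cube_actD cube_act_commute; first by apply: dyn_cube_pair; exact: IH.
exact: cube_allS range_pact_env (host_kra_env HF1).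
Qed.

(** Minimality is the case [k = 0]; afterwards a pair [(F x, g F x)] is the image of the constant
    cube under a Host-Kra element. *)
Lemma host_kra_dense k (x : X) : minimal act ->
  @dyn_cube k `<=` closure [set F *@ cube_const x k | F in @host_kra k].
Proof.
move=> mini; elim: k => [|k IH].
  move=> y _ V /nbhs_interior/nbhs_singleton yV.
  have [z [Vz [g _ gx]]] := mini x V° (ex_intro _ y yV) (@open_interior _ V).
  exists z; split; last exact: interior_subset.
  by exists (pact g) => //; exists g.
apply: closure_sub_closed; first exact: closed_closure.
move=> _ [c Qc [g _ <-]].
pose B := [set F *@ cube_const x k.+1 | F in @host_kra k.+1].
have cB : closed ((fun c => (c, cube_act g c)) @^-1` closure B).
  apply: closed_preimage; last exact: closed_closure.
  apply: continuous_pair; first by move=> ?; exact: cvg_id.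
  exact: continuous_cube_act.
suff sub : [set F *@ cube_const x k | F in @host_kra k] `<=`
    (fun c => (c, cube_act g c)) @^-1` closure B.
  exact: (closure_sub_closed cB sub (IH _ Qc)).
move=> _ [F HF <-]; apply: subset_closure.
exists (F, F *o cube_const (act g : {ptws X -> X}) k).
  by exists F => //; exists g.
rewrite /= cube_appA -[cube_const _ _ *@ _]/(cube_act g _) cube_act_commute //.
exact: cube_allS range_pact_env (host_kra_env HF).
Qed.

(** * Transitivity on dynamical cubes *)

Hypothesis grpE : composition_group E.

Lemma env_inv p : E p ->
  exists q : {ptws X -> X}, [/\ E q, cancel p q & cancel q p].
Proof. exact: (cg_inv grpE). Qed.

(** Stated cube by cube, preservation is a closed condition on [F] even though [F] may be
    discontinuous. *)
Definition doubling k : set (cubeP X k) :=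
  [set F | cube_all E F /\
     forall z, @dyn_cube k.+1 z -> @dyn_cube k.+1 (F *@ z.1, F *@ z.2)].

Lemma doubling_closed k : closed (@doubling k).
Proof.
rewrite (_ : @doubling k = cube_all E (k := k) `&` \bigcap_(z in @dyn_cube k.+1)
    ((fun F => (F *@ z.1, F *@ z.2)) @^-1` @dyn_cube k.+1)); last first.
  by apply/seteqP; split=> F [aF FQ]; split=> // z; exact: FQ.
apply: closedI; first exact: cube_all_env_closed.
apply: closed_bigI => z _.
apply: closed_preimage; last exact: (@dyn_cube_closed k.+1).
by apply: continuous_pair; apply: continuous_cube_map2l; exact: continuous_ptws_app.
Qed.

Lemma doubling_compact k : compact (@doubling k).
Proof.
apply: (subclosed_compact (@doubling_closed k) (compact_cube_all (k := k) env_compact)).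
by move=> ? [].
Qed.

Lemma doubling_comp k F H :
  @doubling k F -> @doubling k H -> @doubling k (F *o H).
Proof.
move=> [aF QF] [aH QH]; split.
  by apply: cube_all_map2 aF aH => p q; exact: (cg_comp grpE).
by move=> z Qz; rewrite !cube_appA; apply: (QF (H *@ z.1, H *@ z.2)); exact: QH.
Qed.

(** The pair [(F, F)] is the Host-Kra element over [F] with [g = 0]. *)
Lemma host_kra_doubling k F : @host_kra k F -> @doubling k F.
Proof.
move=> HF; split; first exact: cube_allS range_pact_env (host_kra_env HF).
move=> z Qz.
have := @host_kra_dyn_cube k.+1
  (F, F *o cube_const (act 0 : {ptws X -> X}) k) z.
rewrite /= cube_appA -[cube_const _ _ *@ _]/(cube_act 0%R _) cube_act_id.
by apply=> //; exists F => //; exists 0%R.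
Qed.

Lemma env_idempotent k (F : cubeP X k) : cube_all E F -> F *o F = F ->
  F = @cube_const {ptws X -> X} id k.
Proof.
elim: k F => [|k IH] F /=.
  move=> /env_inv[q [_ pq _]] FF; apply/funext => x.
  by apply: (can_inj pq); rewrite -[in RHS]FF.
by case: F => F1 F2 [/= a1 a2] [FF1 FF2]; rewrite (IH F1) // (IH F2).
Qed.

(** The vertexwise inverse of [F] has entries in [E], but it must also preserve [Q_(k+1)]. Ellis'
    lemma, applied to the compact semigroup of all [H *o F] with [H] in [doubling], gives an
    idempotent, which is the identity because [E] is a group. *)
Lemma doubling_inv k F : @doubling k F ->
  exists2 H, @doubling k H & H *o F = @cube_const {ptws X -> X} id k.
Proof.
move=> dF.
have cdbl := @doubling_compact k.
have contF (H : cubeP X k) : continuous (fun L => L *o H).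
  by apply: continuous_cube_map2l; exact: continuous_ptws_comp.
have [|||_ [H dH <-] HH] := @ellis_idempotent _ _ ((fun H => H *o F) @` @doubling k)
    (hausdorff_cube (k := k) (hausdorff_ptws hX)) _ _ (@cube_compA X k) contF.
- by apply: continuous_compact => //; exact: continuous_subspaceT.
- by exists (F *o F); exists F.
- move=> _ _ [H dH <-] [L dL <-]; exists (H *o F *o L); last by rewrite !cube_compA.
  by apply: doubling_comp => //; exact: doubling_comp.
- exists H => //; apply: env_idempotent => //.
  by have [] := doubling_comp dH dF.
Qed.

(** The orbit of a constant cube under the compact [doubling] is closed and contains the dense
    Host-Kra orbit, so it is all of [Q_k]. *)
Lemma doubling_transitive k (a c : cube X k) : minimal act ->
  dyn_cube a -> dyn_cube c -> exists2 F, @doubling k F & F *@ a = c.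
Proof.
move=> mini Qa Qc; set x := cube0 a.
have cdbl := @doubling_compact k.
have orbit b : dyn_cube b -> exists2 F, @doubling k F & F *@ cube_const x k = b.
  have cO : closed ((fun F => F *@ cube_const x k) @` @doubling k).
    apply: compact_closed; first exact: hausdorff_cube.
    apply: continuous_compact => //; apply: continuous_subspaceT.
    by apply: continuous_cube_map2l; exact: continuous_ptws_app.
  move=> Qb; apply: (closure_sub_closed cO _ (host_kra_dense x mini Qb)).
  by move=> _ [F HF <-]; exists F => //; exact: host_kra_doubling.
have [F dF <-] := orbit _ Qa; have [H dH <-] := orbit _ Qc.
have [L dL LF] := doubling_inv dF.
exists (H *o L); first exact: doubling_comp.
by rewrite cube_appA -(cube_appA L) LF cube_app_id.
Qed.

(** * Cubes from regional proximality *)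

(** Vertex [eps] carries the translate of [x] by the sum of the [g i] with [eps i = 1]. *)
Fixpoint dcube k (g : nat -> G) (x : X) : cube X k :=
  if k is m.+1 then (dcube m g x, cube_act (g m) (dcube m g x)) else x.

Lemma dyn_cube_dcube k g x : dyn_cube (dcube k g x).
Proof. by elim: k => //= k IH; exact: (@dyn_cube_pair k). Qed.

Lemma cube_actC k g h (c : cube X k) :
  cube_act g (cube_act h c) = cube_act h (cube_act g c).
Proof. by rewrite -(cube_actD g h) addrC cube_actD. Qed.

Lemma dcube_act k g h x : dcube k g (act h x) = cube_act h (dcube k g x).
Proof.
elim: k => //= k ->; congr pair.
exact: cube_actC.
Qed.

Lemma continuous_dcube k g : continuous (dcube k g).
Proof.
elim: k => [|k IH] /=; first by move=> ?; exact: cvg_id.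
apply: continuous_pair => //.
exact: (continuous_comp_fun IH (@continuous_cube_act k (g k))).
Qed.

(** The points are unrelated: by minimality [y] is a limit of translates [h x], whose cubes are the
    diagonal [h]-translates of the cube of [x]. *)
Lemma dyn_cube_dcube_pair k g x y : minimal act ->
  @dyn_cube k.+1 (dcube k g x, dcube k g y).
Proof.
move=> mini.
have cB : closed ((fun y => (dcube k g x, dcube k g y)) @^-1` @dyn_cube k.+1).
  apply: closed_preimage; last exact: (@dyn_cube_closed k.+1).
  by apply: continuous_pair; [move=> ?; exact: cvg_cst | exact: continuous_dcube].
suff sub : [set act h x | h in [set: G]] `<=`
    (fun y => (dcube k g x, dcube k g y)) @^-1` @dyn_cube k.+1.
  apply: (closure_sub_closed cB sub) => V /nbhs_interior/nbhs_singleton yV.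
  have [z [Vz orb]] := mini x V° (ex_intro _ y yV) (@open_interior _ V).
  by exists z; split=> //; exact: interior_subset.
move=> _ [h _ <-]; rewrite /preimage /= dcube_act.
by apply: (@dyn_cube_pair k); exact: dyn_cube_dcube.
Qed.

Local Notation face_sum k g e := (\sum_(i < k) g (i : nat) *+ (e (i : nat) : bool))%R.

Let extend k (e : nat -> bool) (b : bool) (i : nat) : bool :=
  if (i < k)%N then e i else b.

Lemma face_sum_extend k (g : nat -> G) e b :
  face_sum k.+1 g (extend k e b) = (face_sum k g e + g k *+ b)%R.
Proof.
rewrite big_ord_recr /= {2}/extend ltnn; congr (_ + _)%R.
by apply: eq_bigr => i _; rewrite /extend ltn_ord.
Qed.

(** The extra translation [h] collects the steps already taken to upper faces. *)
Lemma cube_rel_dcube k g h x y (r : X -> X -> Prop) :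
  (forall e : nat -> bool,
     r (act (h + face_sum k g e)%R x) (act (h + face_sum k g e)%R y)) ->
  cube_rel r (cube_act h (dcube k g x)) (cube_act h (dcube k g y)).
Proof.
elim: k h => [|k IH] h rh /=.
  by have := rh (fun=> false); rewrite big_ord0 addr0.
split.
  apply: IH => e; have := rh (extend k e false).
  by rewrite face_sum_extend mulr0n addr0.
have := IH (h + g k)%R; rewrite !cube_actD; apply => e; have := rh (extend k e true).
by rewrite face_sum_extend mulr1n addrA addrAC.
Qed.

Lemma cube_rel_off0_dcube k g x y (r : X -> X -> Prop) :
  (forall e : nat -> bool, (exists2 i, (i < k)%N & e i) ->
     r (act (face_sum k g e) x) (act (face_sum k g e) y)) ->
  cube_rel_off0 r (dcube k g x) (dcube k g y).
Proof.
elim: k => [|k IH] re //=.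
split.
  apply: IH => e [i ik ei]; have := re (extend k e false).
  rewrite face_sum_extend mulr0n addr0; apply; exists i; first exact: ltnW.
  by rewrite /extend ik.
apply: cube_rel_dcube => e; have := re (extend k e true).
rewrite face_sum_extend mulr1n addrC; apply; exists k => //.
by rewrite /extend ltnn.
Qed.

Lemma closed_mdist_le (T : topologicalType) (f h : T -> X) (d : R) :
  continuous f -> continuous h -> closed [set t | (mdist (f t) (h t) <= d)%R].
Proof.
move=> cf ch t clt; apply/ler_addgt0Pl => e e0.
have e20 : (0 < e / 2)%R by rewrite divr_gt0.
have ft : nbhs t (f @^-1` ball (f t) (e / 2)) := cf t _ (nbhsx_ballx _ _ e20).
have ht : nbhs t (h @^-1` ball (h t) (e / 2)) := ch t _ (nbhsx_ballx _ _ e20).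
have [s [/= ds [fs hs]]] := clt _ (filterI ft ht).
move: fs hs; rewrite /preimage /= !ballEmdist /= => fs hs.
apply: (le_trans (metric_triangle _ (f s) _)).
rewrite [in leRHS](splitr e) -addrA; apply: lerD; first exact: ltW.
apply: (le_trans (metric_triangle _ (h s) _)).
by rewrite addrC; apply: lerD => //; rewrite metric_sym; exact: ltW.
Qed.

Lemma closed_cube_rel_le k (T : topologicalType) (a b : T -> cube X k) (d : R) :
  continuous a -> continuous b ->
  closed [set t | cube_rel (fun u v => (mdist u v <= d)%R) (a t) (b t)].
Proof.
elim: k a b => [|k IH] a b ca cb /=; first exact: closed_mdist_le.
apply: closedI.
  by apply: IH; [exact: (continuous_comp_fun ca (@continuous_fst _ _)) |
                 exact: (continuous_comp_fun cb (@continuous_fst _ _))].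
by apply: IH; [exact: (continuous_comp_fun ca (@continuous_snd _ _)) |
               exact: (continuous_comp_fun cb (@continuous_snd _ _))].
Qed.

Lemma closed_cube_rel_off0_le k (T : topologicalType) (a b : T -> cube X k)
    (d : R) :
  continuous a -> continuous b ->
  closed [set t | cube_rel_off0 (fun u v => (mdist u v <= d)%R) (a t) (b t)].
Proof.
elim: k a b => [|k IH] a b ca cb /=; first exact: closedT.
apply: closedI.
  by apply: IH; [exact: (continuous_comp_fun ca (@continuous_fst _ _)) |
                 exact: (continuous_comp_fun cb (@continuous_fst _ _))].
by apply: closed_cube_rel_le; [exact: (continuous_comp_fun ca (@continuous_snd _ _)) |
               exact: (continuous_comp_fun cb (@continuous_snd _ _))].
Qed.

Lemma mdist_le_eq (x y : X) : (forall d : R, 0 < d -> mdist x y <= d)%R -> x = y.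
Proof.
move=> h; apply: (@mdist_positivity R X); apply/eqP.
rewrite eq_le mdist_ge0 andbT; apply/ler_addgt0Pl => e e0.
by rewrite addr0; exact: h.
Qed.

Lemma cube_rel_le_eq k (a b : cube X k) :
  (forall d : R, (0 < d)%R -> cube_rel (fun u v => mdist u v <= d)%R a b) ->
  a = b.
Proof.
elim: k a b => [|k IH] a b h; first exact: mdist_le_eq.
case: a b h => a1 a2 [b1 b2] h.
by congr pair; apply: IH => d /h[].
Qed.

Lemma cube_rel_off0_le_eq k (a b : cube X k) :
  (forall d : R, (0 < d)%R -> cube_rel_off0 (fun u v => mdist u v <= d)%R a b) ->
  cube_rel_off0 eq a b.
Proof.
elim: k a b => [|k IH] a b h //=; split; first by apply: IH => d /h[].
rewrite (_ : a.2 = b.2); first exact: cube_rel_refl.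
by apply: cube_rel_le_eq => d /h[].
Qed.

Lemma RP_dyn_cube d x y : minimal act -> RP act d (x, y) ->
  exists a b : cube X d, [/\ @dyn_cube d.+1 (a, b), cube0 a = x, cube0 b = y &
    cube_rel_off0 eq a b].
Proof.
move=> mini xy.
pose near (e : R) (u v : X) := (mdist u v <= e)%R.
(* The strict inequalities of [RP] are weakened so that these sets are closed; a common point over
   all [e] is the desired pair. *)
pose F (e : R) : set (cube X d * cube X d)%type :=
  @dyn_cube d.+1 `&` [set z | near e x (cube0 z.1)] `&`
  [set z | near e y (cube0 z.2)] `&` [set z | cube_rel_off0 (near e) z.1 z.2].
have c1 := @continuous_fst (cube X d) (cube X d).
have c2 := @continuous_snd (cube X d) (cube X d).
have cst (z : X) : continuous (fun _ : (cube X d * cube X d)%type => z).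
  by move=> ?; exact: cvg_cst.
have clF e : closed (F e).
  apply: closedI; last exact: closed_cube_rel_off0_le.
  apply: closedI; last first.
    apply: closed_mdist_le => //.
    exact: (continuous_comp_fun c2 (@continuous_cube0 _ _)).
  apply: closedI; first exact: (@dyn_cube_closed d.+1).
  apply: closed_mdist_le => //.
  exact: (continuous_comp_fun c1 (@continuous_cube0 _ _)).
have cXX : compact [set: (cube X d.+1)].
  by rewrite -cube_allT; apply: compact_cube_all; exact: (ds_compact sys).
have [||| [a b] ab] :=
    @compact_directed_bigcap _ _ _ [set e : R | (0 < e)%R] F cXX.
- by exists 1%R => /=.
- move=> e e0; split=> //; have [x' [y' [g [xx' yy' gd]]]] := xy e e0.
  (* The value beyond [d] is never reached by a cube of dimension [d]. *)
  pose g' (i : nat) := if insub i is Some j then g j else 0%R.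
  have cube0_dcube z : cube0 (dcube d g' z) = z by elim: (d).
  exists (dcube d g' x', dcube d g' y'); split; last first.
    apply: cube_rel_off0_dcube => f [i id fi].
    (* Here [f] is restricted to ['I_d], where it is nonzero because of [i]. *)
    have -> : face_sum d g' f = (\sum_(i < d) g i *+ [ffun i : 'I_d => f i] i)%R.
      by apply: eq_bigr => j _; rewrite ffunE /g' valK.
    apply/ltW/gd => /ffunP/(_ (Ordinal id)).
    by rewrite !ffunE /= fi.
  split; last by rewrite /near /= cube0_dcube; exact: ltW.
  split; last by rewrite /near /= cube0_dcube; exact: ltW.
  exact: dyn_cube_dcube_pair.
- move=> e f /= e0 f0; exists (Num.min e f) => /=; first by rewrite lt_min e0.
  have near1 u v : near (Num.min e f) u v -> near e u v.
    by rewrite /near le_min => /andP[].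
  have near2 u v : near (Num.min e f) u v -> near f u v.
    by rewrite /near le_min => /andP[].
  move=> z [[[Qz xz] yz] rz]; split.
    split; last exact: cube_rel_off0W rz.
    by split; [split=> //; exact: near1 | exact: near1].
  split; last exact: cube_rel_off0W rz.
  by split; [split=> //; exact: near2 | exact: near2].
exists a, b; split.
- by have [[[]]] := ab 1%R ltr01.
- by apply/esym/mdist_le_eq => e /ab[[[]]].
- by apply/esym/mdist_le_eq => e /ab[[]].
- by apply: cube_rel_off0_le_eq => e /ab[].
Qed.

(** * Generic cubes and commutators *)

Definition generic k : set (cube X k) :=
  [set c | forall c', @dyn_cube k.+1 (c, c') ->
     exists2 p, E p & c' = cube_const p k *@ c].

Fixpoint generic_faces k : set (cube X k) :=
  if k is m.+1 then @generic m.+1 `&` [set c | @generic_faces m c.1]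
  else @generic 0.

Lemma generic_facesW k c : @generic_faces k c -> @generic k c.
Proof. by case: k c => [|k] c // []. Qed.

(** Genericity is residual in each dimension; pulling it back along lower faces leaves finitely many
    residual conditions on [c]. *)
Lemma generic_faces_ex k (x : X) :
  exists2 c, @dyn_cube k c & generic_faces c.
Proof.
have cbX : countable_base X by exact: countable_base_compact x (ds_compact sys).
have res m : residual (@dyn_cube m) (@generic m).
  have := residual_orbit_closure (@dyn_cube m) (countable_base_cube m cbX)
    (@continuous_cube_act m).
  by apply: residualS => c gc c' /gc/env_orbit_closure.
have {}res : residual (@dyn_cube k) (@generic_faces k).
  elim: k => [|k IH]; first exact: res.
  exact: residualI (res k.+1) (residual_fst IH).
have cX : compact [set: cube X k].
  by rewrite -cube_allT; apply: compact_cube_all; exact: (ds_compact sys).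
have hc := hausdorff_cube (k := k) hX.
have [|c [Qc gc]] := residual_ex hc cX (@dyn_cube_closed k) _ res.
  by exists (dcube k (fun=> 0%R) x); exact: dyn_cube_dcube.
by exists c.
Qed.

Lemma tlc_env j : top_lower_central E j `<=` E.
Proof.
elim: j => [|j IH] //=; apply: closure_sub_closed; first exact: env_closed.
apply: smallest_sub => // _ [a [a' [b [b' [/IH Ea Eb [aa' a'a] [bb' b'b] ->]]]]].
have cg : forall p q, E p -> E q -> E (p \o q) := cg_comp grpE.
(* The inverses in [commutators] are arbitrary maps; they agree with those supplied by the group
   [E]. *)
have inv p p' : E p -> cancel p p' -> E p'.
  move=> /env_inv[q [Eq pq qp]] pp'.
  suff -> : p' = q by [].
  by apply/funext => z; rewrite -[z in LHS]qp pp'.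
by apply: (cg); [apply: (cg); [exact: cg | exact: (inv a)] | exact: (inv b)].
Qed.

(* If [q] carries the lower face of [c] to the upper one and [p] fixes the upper
   face, then the commutator [p q^-1 p^-1 q] acts on the lower face as [p]. *)
Lemma generic_faces_commutator k j (p : {ptws X -> X}) (c : cube X k) :
  dyn_cube c -> generic_faces c -> top_lower_central E j p ->
  cube_rel_off0 eq c (cube_const p k *@ c) ->
  exists2 p', top_lower_central E (j + k) p' & p' (cube0 c) = p (cube0 c).
Proof.
elim: k j p c => [|k IH] j p c; first by exists p; rewrite ?addn0.
case: c => c1 c2 Qc [_ /= gc1] pj [off1 /cube_rel_eq pc2].
have [q Eq c2E] := generic_facesW gc1 Qc.
have [p1 [Ep1 pp1 p1p]] := env_inv (tlc_env pj).
have [q1 [Eq1 qq1 q1q]] := env_inv Eq.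
(* With [p1] and [q1] the inverses of [p] and [q], this is the commutator of [p] and [q1]. *)
have [r rj rE] : exists2 r : {ptws X -> X}, top_lower_central E j.+1 r &
    r = ptws_comp p (ptws_comp q1 (ptws_comp p1 q)).
  exists (p \o q1 \o p1 \o q) => //; apply: subset_closure => S [gS]; apply.
  by exists p, p1, q1, q; split.
have idE (u v : {ptws X -> X}) (e : cube X k) : cancel v u ->
    cube_const u k *@ (cube_const v k *@ e) = e.
  move=> uv; rewrite cube_app_constA (_ : ptws_comp u v = id) ?cube_app_id //.
  exact/funext.
have {}pc2 : c2 = cube_const p k *@ c2 := pc2.
have p1c2 : cube_const p1 k *@ c2 = c2 by rewrite [in LHS]pc2; exact: idE.
have q1c2 : cube_const q1 k *@ c2 = c1 by rewrite c2E; exact: idE.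
(* Applied to [c1], the factors of [r] give in turn [c2], [c2] again, [c1], and [p c1]. *)
have rc1 : cube_const r k *@ c1 = cube_const p k *@ c1.
  by rewrite -[in RHS]q1c2 -[in RHS]p1c2 c2E !cube_app_constA rE.
(* The lower face [c1] takes the place of [c], with [r] one stage deeper; [r c1 = p c1] still agrees
   with [c1] off vertex 0. *)
have [|p' p'j p'c] := IH j.+1 r c1 (dyn_cubeS_fst Qc) gc1 rj _; first by rewrite rc1.
exists p'; first by rewrite addnS -addSn.
rewrite /= p'c; have := congr1 (@cube0 _ _) rc1; rewrite !cube0_map2.
have c0 (u : {ptws X -> X}) : cube0 (cube_const u k) = u by elim: (k).
by rewrite !c0.
Qed.

Lemma RP_trivial d (x y : X) : minimal act -> step_top_nilpotent d E ->
  RP act d (x, y) -> x = y.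
Proof.
move=> mini nil /(RP_dyn_cube mini)[a [b [Qab a0 b0 ab]]].
have [c Qc gc] := generic_faces_ex d x.
have [F [aF QF] Fa] := doubling_transitive mini (dyn_cubeS_fst Qab) Qc.
(* Applying the same [F] to both halves keeps the pair in [Q_(d+1)] and its agreement off vertex
   0. *)
have Qcb : @dyn_cube d.+1 (c, F *@ b) by have := QF _ Qab; rewrite /= Fa.
have [p Ep pc] := generic_facesW gc Qcb.
have off : cube_rel_off0 eq c (cube_const p d *@ c).
  by rewrite -pc -Fa; exact: cube_rel_off0_app.
(* Stage 0 is [E] itself, and [d] commutators lead to stage [d], which is trivial. *)
have [p' + p'c] := generic_faces_commutator (j := 0) Qc gc Ep off.
rewrite add0n nil => p'id.
(* The entry of [F] at vertex 0 is injective, so [x] and [y] may be compared after applying it. *)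
have [G' [_ F0inj _]] := env_inv (cube_all_cube0 aF).
apply: (can_inj F0inj).
have cube0_const : cube0 (cube_const p d) = p by elim: (d).
have Fx : cube0 F x = cube0 c by rewrite -Fa cube0_map2 a0.
have Fy : cube0 F y = p (cube0 c).
  by have := congr1 (@cube0 _ _) pc; rewrite !cube0_map2 b0 cube0_const.
by rewrite Fx Fy -p'c p'id.
Qed.

End DynamicalCubes.

Theorem theorem1p1 (R : realType) (X : metricType R) (G : zmodType)
    (act : G -> X -> X)
    (countable_G : countable [set: G]%classic)
    (system_act : dynamical_system act)
    (minimal_act : minimal act)
    (nilpotent_E : top_nilpotent_group (enveloping_semigroup act)) :
  system_of_order_infty act.
Proof.
case: nilpotent_E => grpE [d nilE].
apply/seteqP; split=> [[x y] xy | _ [x _ <-] d' _ e e0].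
- have {}xy : RP act d (x, y).
    (* [RP_infty] starts at dimension 1; for [d = 0] the relation holds of every pair, as there is
       no nonzero [eps]. *)
    case: d {nilE} => [|d]; last exact: xy.
    move=> e e0; exists x, y, [ffun=> 0%R]; rewrite !mdistxx; split=> // f [].
    by apply/ffunP => -[].
  by rewrite -(RP_trivial system_act grpE minimal_act nilE xy); exists x.
- exists x, x, [ffun=> 0%R]; rewrite !mdistxx; split=> // f _ /=.
  by rewrite mdistxx.
Qed.
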